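(* There exists a constant $c>0$ such that for every integer $d\geq 2$, \[ SA_d \leq c \left(\frac{\log d}{d}\right)^{1/4}. \]
   Context: $\mathbb{D}^d=\{z=(z_1,\dots,z_d)\in\mathbb{C}^d: |z_1|,\dots,|z_d|<1\}$ is the open unit polydisk. The Schur class $\mathcal{S}_d$ is the set of all analytic $f:\mathbb{D}^d\to\overline{\mathbb{D}}$, where $\overline{\mathbb D}$ is the closed unit disk. The (Schur-)Agler class $\mathcal{A}_d$ is the set of all $f\in\mathcal{S}_d$ such that $\|f(T_1,\dots,T_d)\|\leq 1$ (operator norm) for all $d$-tuples $T=(T_1,\dots,T_d)$ of pairwise commuting strictly contractive operators ($\|T_j\|<1$) on a common complex Hilbert space; here, if $f(z)=\sum_{\alpha\in\mathbb{N}^d} f_\alpha z^\alpha$, then $f(T)=\sum_\alpha f_\alpha T^\alpha$, with $T^\alpha=T_1^{\alpha_1}\cdots T_d^{\alpha_d}$ and $\mathbb{N}$ including $0$. For $0<r<1$ set $f_r(z)=f(rz)$. The Schur-Agler radius is $SA_d=\sup\{r\in(0,1): f_r\in\mathcal{A}_d \text{ for all } f\in\mathcal{S}_d\}$. *)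

(* Defs.v *)
From HB Require Import structures.
From mathcomp Require Import all_boot all_order all_algebra finmap.
From mathcomp Require Import sesquilinear complex.
From mathcomp Require Import all_classical all_reals all_analysis.
From mathcomp Require Import showcase.summability.

Set Implicit Arguments.
Unset Strict Implicit.
Unset Printing Implicit Defensive.

Import Order.TTheory GRing.Theory Num.Theory.
Import numFieldNormedType.Exports.

Local Open Scope classical_set_scope.
Local Open Scope complex_scope.
Local Open Scope ring_scope.

(* R[i] gets the norm and topology that every numFieldType carries on its
   regular module. *)
HB.instance Definition _ (R : realType) := NormedModule.copy R[i] R[i]^o.

(* The inner product is linear in its first argument and conjugate-linear in
   its second. *)
HB.mixin Record CompleteNormedModule_isHilbert (C : numClosedFieldType) H
    of CompleteNormedModule C H := {
  hdot : {dot H for (@Num.conj C)} ;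
  sqr_norm_hdot : forall x : H, `|x| ^+ 2 = hdot x x
}.

#[short(type="hilbertType")]
HB.structure Definition Hilbert (C : numClosedFieldType) :=
  {H of CompleteNormedModule_isHilbert C H & CompleteNormedModule C H}.

Section SchurAgler.
Variable R : realType.
Local Notation C := R[i].

(* The norm of a vector is a nonnegative real of R[i]; [complex.Re] reads it
   in R.  The value is +oo exactly when T is unbounded on the unit ball. *)
Definition opnorm (H : hilbertType C) (T : H -> H) : \bar R :=
  ereal_sup [set (complex.Re `|T x|)%:E | x in [set x : H | `|x| <= 1]].

Variable d : nat.

Definition multi_index := {ffun 'I_d -> nat}.

Definition monomial (z : 'rV[C]_d) (alpha : multi_index) : C :=
  \prod_(j < d) z 0 j ^+ alpha j.

(* The order of the factors is immaterial when the T j commute. *)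
Definition op_monomial (H : hilbertType C) (T : 'I_d -> {linear H -> H})
    (alpha : multi_index) : H -> H :=
  \big[(fun f g : H -> H => f \o g)/idfun]_(j < d) iter (alpha j) (T j).

Definition polydisk : set 'rV[C]_d := [set z | forall j, `|z 0 j| < 1].

(* Multi-index series are summed unconditionally: [totally] is the filter of
   finite sets of indices directed by inclusion. *)
Definition has_power_series (a : multi_index -> C) (w z : 'rV[C]_d) (l : C) :=
  partial_sum (fun alpha => a alpha * monomial (z - w) alpha) @ totally --> l.

Definition analytic_at (f : 'rV[C]_d -> C) (w : 'rV[C]_d) :=
  exists a : multi_index -> C, \forall z \near w, has_power_series a w z (f z).

(* Functions on the polydisk are represented by total functions, whose values
   outside of the polydisk are irrelevant. *)
Definition schur (f : 'rV[C]_d -> C) :=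
  (forall w, polydisk w -> analytic_at f w) /\
  (forall z, polydisk z -> `|f z| <= 1).

Definition taylor (f : 'rV[C]_d -> C) (a : multi_index -> C) :=
  forall z, polydisk z -> has_power_series a 0 z (f z).

(* For strict contractions T j and coefficients a of a Schur function, the
   series converges absolutely in operator norm, so that its pointwise sum is
   its sum in operator norm. *)
Definition fun_calc (a : multi_index -> C) (H : hilbertType C)
    (T : 'I_d -> {linear H -> H}) : H -> H :=
  fun x => lim (partial_sum (fun alpha => a alpha *: op_monomial T alpha x)
                @ totally).

(* By Cauchy's formula a Schur function has exactly one family a such that
   [taylor f a], so that quantifying over all of them is harmless. *)
Definition agler (f : 'rV[C]_d -> C) :=
  schur f /\
  forall a, taylor f a ->
  forall (H : hilbertType C) (T : 'I_d -> {linear H -> H}),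
    (forall j, (opnorm (T j) < 1)%E) ->
    (forall i j x, T i (T j x) = T j (T i x)) ->
    (opnorm (fun_calc a T) <= 1)%E.

Definition dilate (r : R) (f : 'rV[C]_d -> C) : 'rV[C]_d -> C :=
  fun z => f (r%:C *: z).

Definition schur_agler_radius : R :=
  sup [set r | 0 < r < 1 /\ forall f, schur f -> agler (dilate r f)].

End SchurAgler.

(* Main.v *)
Require Import Defs.
From HB Require Import structures.
From mathcomp Require Import all_boot all_order all_algebra finmap.
From mathcomp Require Import sesquilinear complex.
From mathcomp Require Import all_classical all_reals all_analysis.
From mathcomp Require Import showcase.summability.
From mathcomp Require Import zify ring lra.

Set Implicit Arguments.
Unset Strict Implicit.
Unset Printing Implicit Defensive.

Import Order.TTheory GRing.Theory Num.Theory.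
Import numFieldNormedType.Exports.

Local Open Scope classical_set_scope.
Local Open Scope ring_scope.

(** Fix the number d of variables, and let B be a family of subsets of size
    k = 2m + 1 of the d indices, any two of which share at most m points.  To
    signs eps on B corresponds the homogeneous polynomial p(z), the sum over
    the blocks c in B of eps(c) times the product of the z_i with i in c.

    Lower bound on operators ([block_model]).  There are commuting
    contractions T_i on a finite-dimensional Hilbert space and unit vectors
    e, g such that the product of the T_i over a block c sends e to
    eps(c) g; hence p(T) e = |B| g.  Starting from e, the operators record the
    set A of indices applied so far, until |A| = m + 1.  At that moment at most
    one block c contains A, and from then on only the set c \ A of indices
    still missing is recorded.  Each T_i permutes part of an orthonormal basis
    up to signs: forwards, A is recovered from A and i together; backwards,
    c \ A together with i has m + 1 elements and so determines c.

    Upper bound on the polydisk ([exists_small_signed_poly]).  The disk of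
    radius 1/2 lies in the convex hull of the fourth roots of unity and p is
    affine in each variable, so up to a factor 2^k it suffices to bound p on
    4^d points.  For random signs, the Chernoff bound at all of these points
    simultaneously gives |p| <= 2^(k+1) sqrt(32 |B| d) on the polydisk.

    Comparison ([agler_bound], [radius_bound]).  If every Schur function
    becomes Agler after dilation by r, then applying this to p divided by its
    bound gives r^k |B| <= 2^(k+1) sqrt(32 |B| d).  A maximal family B
    satisfies |B| 4^k >= C(d, m+1) >= (d/(m+1))^(m+1) ([exists_packing]).  With
    n = m + 1 this becomes (r^4 d / (256 n))^n <= 8 d.  The factor 8 d is
    harmless as soon as 2^n >= 8 d, which costs only n of the order of log d:
    then r^4 d <= 512 n, a multiple of log d. *)

(** * Finite-dimensional Hilbert spaces *)

Lemma norm_im_unit (R : realType) : `|'i%C : R[i]| = 1.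
Proof. by rewrite normc_def/= expr0n/= expr1n add0r sqrtr1. Qed.

Lemma norm_real_complex (R : realType) (x : R) : `|(x%:C)%C| = (`|x|%:C)%C.
Proof. by rewrite normc_def/= expr0n/= addr0 sqrtr_sqr. Qed.

(** The values are taken in the regular module so that the vector space
    structure of finite functions applies. *)
Definition l2 (R : realType) (X : finType) := {ffun X -> R[i]^o}.

Section L2.
Variables (R : realType) (X : finType).
Local Notation C := R[i].
Local Notation l2 := (l2 R X).

HB.instance Definition _ := Vector.on l2.

Definition l2dot (u v : l2) : C := \sum_s (u s : C) * Num.conj (v s : C).

Lemma l2dot_linearl v : linear_for *%R (l2dot^~ v).
Proof.
move=> a u w; rewrite /l2dot mulr_sumr -big_split; apply: eq_bigr => s _ /=.
by rewrite !ffunE mulrDl mulrA.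
Qed.

Lemma l2dot_linearr u : linear_for (Num.conj \; *%R) (l2dot u).
Proof.
move=> a v w; rewrite /l2dot /= mulr_sumr -big_split; apply: eq_bigr => s _ /=.
by rewrite !ffunE rmorphD rmorphM mulrDr mulrCA.
Qed.

HB.instance Definition _ :=
  bilinear_isBilinear.Build C l2 l2 C *%R (Num.conj \; *%R) l2dot
    (l2dot_linearl, l2dot_linearr).

Lemma l2dot_hermitian u v : l2dot u v = (-1) ^+ false * Num.conj (l2dot v u).
Proof.
rewrite mul1r /l2dot rmorph_sum; apply: eq_bigr => s _ /=.
by rewrite rmorphM [in RHS]mulrC; congr (_ * _); rewrite [RHS]conjCK.
Qed.

HB.instance Definition _ :=
  isHermitianSesquilinear.Build C l2 false Num.conj l2dot l2dot_hermitian.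

Lemma l2dot_gt0 u : u != 0 -> 0 < l2dot u u.
Proof.
move=> u0; have [s us0] : exists s, u s != 0.
  apply/existsP; apply: contraNT u0 => /existsPn u0.
  by apply/eqP/ffunP => s; rewrite ffunE; apply/eqP; rewrite -[_ == _]negbK u0.
rewrite /l2dot (bigD1 s)//= ltr_wpDr//.
  by apply: sumr_ge0 => i _; rewrite -normCK exprn_ge0.
by rewrite -normCK exprn_gt0// normr_gt0.
Qed.

HB.instance Definition _ := isDotProduct.Build C l2 l2dot l2dot_gt0.

Lemma l2dotZ a u b v : l2dot (a *: u) (b *: v) = a * Num.conj b * l2dot u v.
Proof. by rewrite linearZl_LR linearZr_LR /= mulrA. Qed.

Lemma l2dot0l u : l2dot 0 u = 0.
Proof. exact: linear0l. Qed.

Lemma l2dot0r u : l2dot u 0 = 0.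
Proof. exact: linear0r. Qed.

Lemma l2dot_suml I (r : seq I) (F : I -> l2) v :
  l2dot (\sum_(i <- r) F i) v = \sum_(i <- r) l2dot (F i) v.
Proof. exact: linear_sumlz. Qed.

Lemma l2dot_sumr I (r : seq I) u (F : I -> l2) :
  l2dot u (\sum_(i <- r) F i) = \sum_(i <- r) l2dot u (F i).
Proof. exact: linear_sumr. Qed.

Definition l2norm (u : l2) : C := sqrtC (l2dot u u).

Lemma l2normD u v : l2norm (u + v) <= l2norm u + l2norm v.
Proof. exact: (triangle_lerif (l2dot : {dot l2 for Num.conj})). Qed.

Lemma l2normZ a u : l2norm (a *: u) = `|a| * l2norm u.
Proof.
rewrite /l2norm (dnormZ (l2dot : {dot l2 for Num.conj})) sqrtCM ?nnegrE ?exprn_ge0//.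
  by rewrite sqrCK.
Qed.

Lemma l2norm_eq0 u : l2norm u = 0 -> u = 0.
Proof.
by move=> /eqP; rewrite (sqrt_dnorm_eq0 (l2dot : {dot l2 for Num.conj})) => /eqP.
Qed.

HB.instance Definition _ := Lmodule_isNormed.Build C l2 l2normD l2normZ l2norm_eq0.

Lemma sqr_l2norm (u : l2) : `|u| ^+ 2 = l2dot u u.
Proof. by rewrite sqrtCK. Qed.

Definition l2delta (s : X) : l2 := [ffun t => (t == s)%:R].

Lemma l2_expand (u : l2) : u = \sum_s u s *: l2delta s.
Proof.
apply/ffunP => t; rewrite sum_ffunE (bigD1 t)//= big1 ?addr0.
  by rewrite !ffunE eqxx [RHS]mulr1.
by move=> s /negPf st; rewrite !ffunE eq_sym st [LHS]mulr0.
Qed.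

Lemma l2dot_delta s t : l2dot (l2delta s) (l2delta t) = (s == t)%:R.
Proof.
rewrite /l2dot (bigD1 s)//= !ffunE eqxx mul1r conjC_nat big1 ?addr0// => i.
by rewrite ffunE => /negPf ->; rewrite mul0r.
Qed.

Lemma norm_l2delta s : `|l2delta s| = 1.
Proof. by rewrite /Num.norm/= /l2norm l2dot_delta eqxx sqrtC1. Qed.

Lemma l2norm_le_sum (u : l2) : `|u| <= \sum_s `|u s : C|.
Proof.
rewrite [in leLHS](l2_expand u); apply: le_trans (ler_norm_sum _ _ _) _.
by apply: ler_sum => s _; rewrite normrZ norm_l2delta mulr1.
Qed.

Lemma l2_coord_le (u : l2) s : `|u s : C| <= `|u|.
Proof.
rewrite -ler_sqr ?nnegrE// sqr_l2norm /l2dot (bigD1 s)//= -normCK lerDl.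
by apply: sumr_ge0 => t _; rewrite -normCK exprn_ge0.
Qed.

(** Each real coordinate of a Cauchy filter is Cauchy in the reals, and the
    finitely many limits assemble into a limit for the norm. *)
Lemma l2_complete (F : set_system l2) : ProperFilter F -> cauchy F -> cvg F.
Proof.
move=> FF Fc.
have coord_cvg (phi : l2 -> R) : (forall u v, phi (u - v) = phi u - phi v) ->
    (forall u, (`|phi u|%:C)%C <= `|u|) -> cvg (phi @ F).
  move=> phiB phi_le; apply: R_complete; apply/cauchyP => e e0.
  have /cauchyP/(_ (e%:C)%C) := Fc; rewrite ltcR => /(_ e0)[u Fu].
  exists (phi u).
  apply: (@filterS _ F _ (ball u (e%:C)%C) (phi @^-1` ball (phi u) e)) => // v.
  rewrite /preimage -!ball_normE /= => uv.
  by rewrite -ltcR -phiB (le_lt_trans (phi_le _)).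
have re_cvg s : cvg ((fun u : l2 => complex.Re (u s)) @ F).
  apply: coord_cvg => [u v|u]; first by rewrite !ffunE raddfB.
  exact: le_trans (normc_ge_Re _) (l2_coord_le u s).
have im_cvg s : cvg ((fun u : l2 => complex.Im (u s)) @ F).
  apply: coord_cvg => [u v|u]; first by rewrite !ffunE raddfB.
  apply: le_trans (l2_coord_le u s).
  by rewrite -normrN -ReiNIm (le_trans (normc_ge_Re _))// normrM norm_im_unit mulr1.
pose l : l2 := [ffun s => (lim ((fun u : l2 => complex.Re (u s)) @ F) +i*
   lim ((fun u : l2 => complex.Im (u s)) @ F))%C].
apply/cvg_ex; exists l; apply/fcvgrPdist_lt => e e0.
have [e' ee'] : exists e', e = (e'%:C)%C.
  by apply/complex_realP; rewrite gtr0_real.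
move: e0; rewrite {}ee' ltcR => e0.
pose b : R := e' / (2 * (#|X|%:R + 1)).
have b0 : 0 < b by rewrite divr_gt0// mulr_gt0// ltr_wpDl.
have FX : \forall u \near F, forall s : X,
   `|complex.Re (l s) - complex.Re ((u : l2) s)| < b /\
   `|complex.Im (l s) - complex.Im ((u : l2) s)| < b.
  apply: filter_forall => s; apply: filterI.
    by have /cvgrPdist_lt/(_ _ b0) := re_cvg s; rewrite ffunE.
  by have /cvgrPdist_lt/(_ _ b0) := im_cvg s; rewrite ffunE.
apply: filterS FX => u lu.
have : `|l - u| <= \sum_(s : X) ((b *+ 2)%:C)%C.
  apply: le_trans (l2norm_le_sum _) _; apply: ler_sum => s _.
  have [Re_le Im_le] := lu s.
  rewrite [X in `|X|]complexE (le_trans (ler_normD _ _))// normrM norm_im_unit mul1r.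
  rewrite !norm_real_complex mulr2n raddfD /= lerD// lecR.
    by move: Re_le; rewrite !ffunE raddfB => /ltW.
  by move: Im_le; rewrite !ffunE raddfB => /ltW.
move=> /le_lt_trans; apply.
rewrite sumr_const -raddfMn ltcR -mulrnA -mulr_natl /b mulrA ltr_pdivrMr ?mulr_gt0 ?ltr_wpDl//.
rewrite [ltLHS]mulrC ltr_pM2l// natrM ltr_pM2l// ltrDl//.
Qed.

HB.instance Definition _ := Uniform_isComplete.Build l2 l2_complete.
HB.instance Definition _ := CompleteNormedModule_isHilbert.Build C l2 sqr_l2norm.

End L2.

(** * Commuting contractions attached to a packing of blocks *)

Section MatrixOperator.
Variables (R : realType) (X : finType).
Local Notation C := R[i].
Local Notation l2 := (l2 R X).
Variable col : X -> l2.

Definition l2op (u : l2) : l2 := \sum_s u s *: col s.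

Lemma l2op_linear : linear l2op.
Proof.
move=> a u v; rewrite /l2op scaler_sumr -big_split; apply: eq_bigr => s _ /=.
by rewrite !ffunE scalerDl scalerA.
Qed.

HB.instance Definition _ := GRing.isLinear.Build C l2 l2 *:%R l2op l2op_linear.

Lemma l2op_delta s : l2op (l2delta R s) = col s.
Proof.
rewrite /l2op (bigD1 s)//= ffunE eqxx scale1r big1 ?addr0// => t /negPf ts.
by rewrite ffunE ts scale0r.
Qed.

(** With orthogonal columns, the square of the norm of the image is the sum of
    the |u s|^2 weighted by the squared norms of the columns. *)
Lemma l2op_contraction : (forall s t, s != t -> l2dot (col s) (col t) = 0) ->
  (forall s, l2dot (col s) (col s) <= 1) -> forall u, `|l2op u| <= `|u|.
Proof.
move=> col_orth col_le1 u; rewrite -ler_sqr ?nnegrE// !sqr_l2norm.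
have -> : l2dot (l2op u) (l2op u) =
    \sum_s (u s : C) * Num.conj (u s : C) * l2dot (col s) (col s).
  rewrite [in LHS]/l2op l2dot_suml; apply: eq_bigr => s _.
  rewrite l2dot_sumr (bigD1 s)//= big1 ?addr0 ?l2dotZ// => t ts.
  by rewrite l2dotZ col_orth ?mulr0 1?eq_sym.
rewrite [leRHS]/l2dot; apply: ler_sum => s _.
by rewrite -[leRHS]mulr1 ler_wpM2l// -normCK exprn_ge0.
Qed.

End MatrixOperator.

(** The basis vectors (J, false) record the set J of indices applied so far,
    and the basis vectors (K, true) the set K of indices that remain to be
    applied in order to complete a block. *)
Definition block_state (D : finType) : finType := ({set D} * bool)%type.

Section BlockOperators.
Variables (R : realType) (D : finType) (m : nat).
Variables (B : {set {set D}}) (eps : {set D} -> bool).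
Hypothesis cardB : forall c, c \in B -> #|c| = m.*2.+1.
Hypothesis interB : forall c c', c \in B -> c' \in B -> c != c' ->
  (#|c :&: c'| <= m)%N.
Local Notation C := R[i].
Local Notation X := (block_state D).
Local Notation l2 := (l2 R X).

Definition block_of (A : {set D}) : option {set D} :=
  [pick c in B | A \subset c].

Lemma block_of_some (A c : {set D}) : c \in B -> A \subset c -> (m < #|A|)%N ->
  block_of A = Some c.
Proof.
move=> cB Ac mA; rewrite /block_of; case: pickP => [c' /andP[c'B Ac']|].
  apply/eqP; rewrite -[_ == _]negbK; apply/negP => c'c.
  have := interB c'B cB c'c; rewrite leqNgt => /negP; apply.
  by apply: leq_trans mA (subset_leq_card _); rewrite finset.subsetI Ac'.
by move=> /(_ c); rewrite cB Ac.
Qed.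

Definition up_vec (A : {set D}) : l2 := l2delta R ((A, false) : X).
Definition down_vec (K : {set D}) : l2 := l2delta R ((K, true) : X).

(** By [blockop_vec] this is the image of the basis vector of the empty set
    under the product of the operators indexed by A.  Above size m only the
    complement of A in its block survives, so that different A may give
    proportional vectors. *)
Definition block_vec (A : {set D}) : l2 :=
  if (#|A| <= m)%N then up_vec A
  else if block_of A is Some c then (-1) ^+ eps c *: down_vec (c :\: A) else 0.

(** The bound on the size of J separates the two ways to reach a vector
    [down_vec]: exactly m missing indices when a block has just been
    recognized, and fewer when an index is removed. *)
Definition column (i : D) (s : X) : l2 :=
  let: (J, b) := s in
  if (#|J| <= m)%N then
    if b then if i \in J then down_vec (J :\ i) else 0
    else if i \in J then 0 else block_vec (i |: J)
  else 0.

Definition blockop (i : D) := l2op (column i).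

HB.instance Definition _ i := GRing.Linear.on (blockop i).

Lemma blockop_delta i s : blockop i (l2delta R s) = column i s.
Proof. exact: l2op_delta. Qed.

Lemma blockopZ i a u : blockop i (a *: u) = a *: blockop i u.
Proof. exact: linearZ. Qed.

Lemma blockop0 i : blockop i 0 = 0.
Proof. exact: linear0. Qed.

Lemma blockop_sum i (I : finType) (F : I -> l2) :
  blockop i (\sum_s F s) = \sum_s blockop i (F s).
Proof. exact: linear_sum. Qed.

(** If A has more than m points and lies in the block c, an index outside of c
    kills the vector, because no other block can contain A. *)
Lemma blockop_vec i A :
  blockop i (block_vec A) = if i \in A then 0 else block_vec (i |: A).
Proof.
rewrite {1}/block_vec; case: leqP => [Am|mA].
  by rewrite blockop_delta/= Am.
case bA: (block_of A) => [c|]; last first.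
  rewrite linear0; case: ifP => // iA.
  rewrite /block_vec leqNgt cardsU1 iA (leq_trans mA)//= /block_of.
  case: pickP => // c /andP[cB]; rewrite finset.subUset => /andP[_ Ac].
  by rewrite (block_of_some cB Ac) in bA.
have [cB Ac] : c \in B /\ A \subset c.
  by move: bA; rewrite /block_of; case: pickP => // c' /andP[cB Ac] [<-].
have cA : (#|c :\: A| <= m)%N.
  by rewrite cardsDS// cardB// leq_subLR -addnn -addSn leq_add2r.
rewrite blockopZ/= blockop_delta/= cA finset.in_setD.
case iA: (i \in A) => /=; first by rewrite scaler0.
have mAi : (m < #|i |: A|)%N by rewrite cardsU1 iA (leq_trans mA).
rewrite /block_vec leqNgt mAi/=; case: ifP => ic.
  have iAc : i |: A \subset c by rewrite finset.subUset finset.sub1set ic Ac.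
  rewrite (block_of_some cB iAc mAi).
  congr (_ *: down_vec _); apply/setP => x; rewrite !inE.
  by rewrite negb_or andbA.
case bAi: (block_of _) => [c'|]; last by rewrite scaler0.
exfalso; move: bAi; rewrite /block_of; case: pickP => // c'' /andP[c'B iAc] [?]; subst c''.
have Ac' : A \subset c'.
  by apply: fintype.subset_trans iAc; rewrite finset.subsetUr.
have := block_of_some c'B Ac' mA; rewrite bA => -[cc'].
by move: iAc; rewrite finset.subUset finset.sub1set -cc' ic.
Qed.

(** On a basis vector both compositions add, or remove, the two indices. *)
Lemma blockopC i j u : blockop i (blockop j u) = blockop j (blockop i u).
Proof.
suff delta_comm s :
    blockop i (blockop j (l2delta R s)) = blockop j (blockop i (l2delta R s)).
  have expand k l : blockop k (blockop l u) =
      \sum_s u s *: blockop k (blockop l (l2delta R s)).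
    rewrite {1}(l2_expand u) [blockop l _]blockop_sum blockop_sum.
    by apply: eq_bigr => s _; rewrite [blockop l _]blockopZ blockopZ.
  by rewrite !expand; apply: eq_bigr => s _; rewrite delta_comm.
rewrite !blockop_delta; case: s => J b; rewrite /column.
case: (leqP #|J| m) => [Jm|_].
  2: by rewrite (blockop0 i) (blockop0 j).

case: b.
  have downE k l : blockop k (if l \in J then down_vec (J :\ l) else 0) =
      if [&& l \in J, k \in J & k != l] then down_vec (J :\ l :\ k) else 0.
    case: ifP => lJ; last by rewrite blockop0.
    rewrite blockop_delta/= finset.in_setD1 andbC.
    by rewrite (leq_trans (subset_leq_card _) Jm)// finset.subsetDl.
  rewrite !downE; rewrite andbCA eq_sym; case: ifP => // _; congr (down_vec _).
  by apply/setP => x; rewrite !inE andbCA.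
have upE k l : blockop k (if l \in J then 0 else block_vec (l |: J)) =
    if [&& l \notin J, k \notin J & k != l] then block_vec (k |: (l |: J)) else 0.
  case: ifP => lJ; first by rewrite blockop0.
  by rewrite blockop_vec !inE; case: (k == l); case: (k \in J).
by rewrite !upE andbCA eq_sym finset.setUCA.
Qed.

(** The operator [blockop i] permutes part of the basis up to signs, so the
    index of a nonzero column is determined by the basis vector it hits. *)
Definition column_source (i : D) (t : X) : X :=
  let: (A, b) := t in
  if b then
    if (#|A| < m)%N then (i |: A, true)
    else (odflt A (block_of (i |: A)) :\: (i |: A), false)
  else (A :\ i, false).

Lemma columnP i s : column i s = 0 \/
  exists b t, column i s = (-1) ^+ b *: l2delta R t /\ s = column_source i t.
Proof.
case: s => J b; rewrite /column; case: leqP => Jm; last by left.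
case: b; case: ifP => iJ; try by left.
  right; exists false, (J :\ i, true); rewrite expr0 scale1r; split=> //=.
  by rewrite (cardsD1 i) iJ in Jm; rewrite Jm finset.setD1K.
rewrite /block_vec; case: leqP => iJm.
  right; exists false, (i |: J, false); rewrite expr0 scale1r; split=> //=.
  by rewrite finset.setU1K ?iJ.
case biJ: (block_of _) => [c|]; last by left.
right; exists (eps c), (c :\: (i |: J), true); split=> //=.
have [cB iJc] : c \in B /\ (i |: J) \subset c.
  by move: biJ; rewrite /block_of; case: pickP => // c' /andP[cB Ac] [<-].
have ciJm : #|c :\: (i |: J)| = m.
  apply/eqP; rewrite cardsDS// cardB//.
  have -> : #|i |: J| = m.+1.
    by apply/eqP; rewrite eqn_leq iJm andbT cardsU1 iJ.
  by rewrite subSS -addnn addnK.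
rewrite ciJm ltnn; move: iJc; rewrite finset.subUset finset.sub1set => /andP[ic Jc].
have ciJc : (i |: (c :\: (i |: J))) \subset c.
  by rewrite finset.subUset finset.sub1set ic finset.subsetDl.
rewrite (block_of_some cB ciJc)/=; last by rewrite cardsU1 !inE eqxx ciJm.
congr (_, _); apply/setP => x; rewrite !inE; case: eqP => [->|_] /=.
  by rewrite iJ.
by case xJ: (x \in J); case xc: (x \in c) => //=; rewrite (fintype.subsetP Jc) in xc.
Qed.

Lemma column_orth i s t : s != t -> l2dot (column i s) (column i t) = 0.
Proof.
have [->|[b [s' [-> ->]]]] := columnP i s; first by rewrite l2dot0l.
have [->|[b' [t' [-> ->]]]] := columnP i t; first by rewrite l2dot0r.
move=> /eqP st; rewrite l2dotZ l2dot_delta.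
by case: (s' =P t') => [s't'|_]; [rewrite s't' in st|rewrite mulr0].
Qed.

Lemma column_le1 i s : l2dot (column i s) (column i s) <= 1.
Proof.
have [->|[b [s' [-> _]]]] := columnP i s; first by rewrite l2dot0l ler01.
by rewrite l2dotZ l2dot_delta eqxx mulr1 -normCK normrX normrN1 !expr1n.
Qed.

Lemma blockop_contraction i u : `|blockop i u| <= `|u|.
Proof.
by apply: l2op_contraction => [s t|s]; [exact: column_orth|exact: column_le1].
Qed.
(** The construction as an abstract Hilbert space, which hides the concrete
    basis from the rest of the argument.  The vector v A is the image of
    v set0 under the product of the T i with i in A. *)
Theorem block_model : exists (H : hilbertType C) (T : D -> {linear H -> H})
    (v : {set D} -> H) (g : H),
  [/\ forall i x, `|T i x| <= `|x|,
      forall i j x, T i (T j x) = T j (T i x),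
      forall i A, T i (v A) = if i \in A then 0 else v (i |: A),
      forall c, c \in B -> v c = (-1) ^+ eps c *: g
    & `|v finset.set0| = 1 /\ `|g| = 1].
Proof.
exists l2, (fun i => blockop i : {linear _ -> _}), block_vec, (down_vec finset.set0).
split; [exact: blockop_contraction|exact: blockopC|exact: blockop_vec| |].
  move=> c cB; have mc : (m < #|c|)%N by rewrite cardB// ltnS -addnn leq_addr.
  have cc : c \subset c by [].
  by rewrite /block_vec leqNgt mc/= (block_of_some cB cc mc) finset.setDv.
by rewrite /block_vec cards0; split; exact: norm_l2delta.
Qed.

End BlockOperators.

(** * Power series of multi-affine polynomials *)

#[local] Existing Instance totally_filter.

(** A family that is supported on the image of a finite type is summed exactly by
    every large enough finite set of indices. *)
Lemma cvg_partial_sum_fin (I : finType) (K : choiceType) (F : numFieldType)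
    (V : normedModType F) (h : I -> K) (g : I -> V) :
  partial_sum (fun k => \sum_(i | h i == k) g i) @ totally --> \sum_i g i.
Proof.
apply: cvg_near_cst.
have : totally [set S : {fset K} | [fset h i | i in I] `<=` S]%fset.
  by exists [fset h i | i in I]%fset.
apply: filterS => S /= hS.
rewrite /partial_sum (exchange_big_dep xpredT)//=; apply: eq_bigr => i _.
have hiS : h i \in S by apply: (fsubsetP hS); apply/imfsetP; exists i.
by rewrite (big_pred1 [` hiS]%fset)// => k /=; rewrite -val_eqE/= eq_sym.
Qed.

Section MultiAffine.
Variables (R : realType) (d : nat).
Local Notation C := R[i].
Implicit Types (b : {set 'I_d} -> C) (z w : 'rV[C]_d).

Definition multi_affine b z : C := \sum_A b A * \prod_(i in A) z 0 i.

Definition subset_index (A : {set 'I_d}) : multi_index d := [ffun i => (i \in A) : nat].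

(** A fibre sum over the injective [subset_index]: it vanishes at the
    multi-indices that have an exponent above 1. *)
Definition coef b (alpha : multi_index d) : C := \sum_(A | subset_index A == alpha) b A.

Lemma monomial_subset_index z A : monomial z (subset_index A) = \prod_(i in A) z 0 i.
Proof.
rewrite /monomial [RHS]big_mkcond; apply: eq_bigr => i _; rewrite ffunE.
by case: ifP.
Qed.

Lemma multi_affine_series b w z :
  has_power_series (coef b) w z (multi_affine b (z - w)).
Proof.
rewrite /has_power_series.
rewrite (_ : (fun alpha => _) = fun alpha => \sum_(A | subset_index A == alpha)
    b A * \prod_(i in A) (z - w) 0 i); first exact: cvg_partial_sum_fin.
apply/funext => alpha; rewrite /coef mulr_suml; apply: eq_bigr => A /eqP <-.
by rewrite monomial_subset_index.
Qed.

Lemma multi_affine_taylor b : taylor (multi_affine b) (coef b).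
Proof. by move=> z _; have := @multi_affine_series b 0 z; rewrite subr0. Qed.

(** The coefficient of the monomial of A in z - w: expand every product over c
    of the factors w i + (z i - w i), where A selects the second terms. *)
Definition recenter w b (A : {set 'I_d}) : C := \sum_c b c *
  \prod_i (if i \in A then (i \in c)%:R else if i \in c then w 0 i else 1).

Lemma multi_affine_recenter b w z :
  multi_affine b z = multi_affine (recenter w b) (z - w).
Proof.
rewrite /multi_affine /recenter.
under [RHS]eq_bigr do rewrite mulr_suml.
rewrite exchange_big/=; apply: eq_bigr => c _.
under [RHS]eq_bigr do rewrite -mulrA.
rewrite -mulr_sumr; congr (_ * _).
pose u := fun i => if i \in c then (z - w) 0 i else 0.
pose v := fun i => if i \in c then w 0 i else 1.
transitivity (\prod_i (u i + v i)).
  rewrite big_mkcond; apply: eq_bigr => i _; rewrite /u /v.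
  by case: ifP; rewrite ?add0r// !mxE subrK.
rewrite bigA_distr/=; apply: eq_bigr => A _.
rewrite [X in _ * X]big_mkcond -big_split/=; apply: eq_bigr => i _.
by rewrite /u /v; case: (i \in A); case: (i \in c); rewrite ?mul1r ?mulr1 ?mul0r.
Qed.

Lemma multi_affine_schur b :
  (forall z, polydisk z -> `|multi_affine b z| <= 1) -> schur (multi_affine b).
Proof.
move=> b_le1; split=> // w _; exists (coef (recenter w b)).
apply: (filterS _ (@filterT _ _ (nbhs_filter w))) => z _.
rewrite (multi_affine_recenter b w); exact: multi_affine_series.
Qed.

Lemma dilate_multi_affine r b :
  dilate r (multi_affine b) = multi_affine (fun A => b A * (r%:C ^+ #|A|)%C).
Proof.
apply/funext => z; apply: eq_bigr => A _; rewrite -mulrA; congr (_ * _).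
by rewrite -prodr_const -big_split/=; apply: eq_bigr => i _; rewrite mxE.
Qed.

Lemma fun_calc_multi_affine b (H : hilbertType C) (T : 'I_d -> {linear H -> H}) x :
  fun_calc (coef b) T x = \sum_A b A *: op_monomial T (subset_index A) x.
Proof.
rewrite /fun_calc.
rewrite (_ : (fun alpha => _) = fun alpha => \sum_(A | subset_index A == alpha)
    b A *: op_monomial T (subset_index A) x).
  by apply: cvg_lim; [exact: norm_hausdorff|exact: cvg_partial_sum_fin].
apply/funext => alpha; rewrite /coef scaler_suml; apply: eq_bigr => A /eqP <- //.
Qed.

End MultiAffine.

(** * Evaluation of a signed block polynomial on the operators *)

Section MonomialAction.
Variables (R : realType) (d : nat) (H : hilbertType R[i]).
Variables (T : 'I_d -> {linear H -> H}) (v : {set 'I_d} -> H).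
Hypothesis Tv : forall i A, T i (v A) = if i \in A then 0 else v (i |: A).
Variable a : R[i].

(** The operators act one at a time, so it is enough to follow the part of c
    that has been met along the enumeration of the indices. *)
Lemma op_monomial_subset_index (c : {set 'I_d}) :
  op_monomial (fun i => a \*: T i) (subset_index c) (v finset.set0) = a ^+ #|c| *: v c.
Proof.
pose F (i : 'I_d) : H -> H := iter (i \in c) (a \*: T i).
suff foldr_v l : uniq l ->
    (\big[(fun f g : H -> H => f \o g)/idfun]_(i <- l) F i) (v finset.set0) =
    a ^+ #|c :&: [set i in l]| *: v (c :&: [set i in l]).
  rewrite /op_monomial (eq_bigr F) => [|i _]; last by rewrite ffunE.
  rewrite foldr_v ?index_enum_uniq//.
  suff -> : c :&: [set i in index_enum 'I_d] = c by [].
  by apply/setP => i; rewrite !inE mem_index_enum andbT.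
elim: l => [_|i l IHl /= /andP[il /IHl {}IHl]].
  suff -> : c :&: [set i in [::]] = finset.set0.
    by rewrite big_nil cards0 expr0 scale1r.
  by apply/setP => i; rewrite !inE andbF.
rewrite big_cons /comp {}IHl /F; case: (boolP (i \in c)) => ic /=.
  rewrite linearZ/= Tv.
  have iE : i |: (c :&: [set i in l]) = c :&: [set i0 in i :: l].
    by apply/setP => x; rewrite !inE; case: eqP => [->|//]; rewrite ic.
  have icl : i \notin c :&: [set i in l] by rewrite !inE negb_and il orbT.
  by rewrite (negbTE icl) iE scalerA -iE cardsU1 icl add1n exprS.
suff -> : c :&: [set i0 in i :: l] = c :&: [set i in l] by [].
by apply/setP => x; rewrite !inE; case: eqP => [->|//]; rewrite (negbTE ic).
Qed.

End MonomialAction.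

Section Separation.
Variables (R : realType) (d m : nat).
Variables (B : {set {set 'I_d}}) (eps : {set 'I_d} -> bool).
Hypothesis cardB : forall c, c \in B -> #|c| = m.*2.+1.
Hypothesis interB : forall c c', c \in B -> c' \in B -> c != c' ->
  (#|c :&: c'| <= m)%N.
Local Notation C := R[i].

Definition signed_poly (z : 'rV[C]_d) : C :=
  \sum_(c in B) (-1) ^+ eps c * \prod_(i in c) z 0 i.

(** The factor s makes the operators of [block_model] strict contractions. *)
Lemma agler_bound (M r s : R) : 0 < M ->
  (forall z, polydisk z -> `|signed_poly z| <= (M%:C)%C) ->
  0 < r -> (forall f : 'rV[C]_d -> C, schur f -> agler (dilate r f)) ->
  0 < s < 1 -> (r * s) ^+ m.*2.+1 * #|B|%:R <= M.
Proof.
move=> M0 p_le r0 r_agler /andP[s0 s1].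
pose b c : C := if c \in B then (-1) ^+ eps c / (M%:C)%C else 0.
have MC0 : 0 < (M%:C)%C :> C by rewrite ltcR.
have bE z : multi_affine b z = signed_poly z / (M%:C)%C.
  rewrite /multi_affine /signed_poly mulr_suml [RHS]big_mkcond/=.
  by apply: eq_bigr => c _; rewrite /b; case: ifP; rewrite ?mul0r// mulrAC.
have b_schur : schur (multi_affine b).
  apply: multi_affine_schur => z zD; rewrite bE normrM normfV (gtr0_norm MC0).
  by rewrite ler_pdivrMr// mul1r p_le.
have [H [T [v [g [T_le TC Tv vB [v0 g1]]]]]] := block_model R eps cardB interB.
pose sT i : {linear H -> H} := (s%:C)%C \*: T i.
have sT_lt1 i : (opnorm (sT i) < 1)%E.
  apply: (@le_lt_trans _ _ s%:E); last by rewrite lte_fin.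
  apply: ge_ereal_sup => _ [x /= x1 <-]; rewrite lee_fin.
  have : `|(s%:C)%C *: T i x| <= (s%:C)%C.
    have sC0 : 0 <= (s%:C)%C :> C by rewrite ler0c ltW.
    rewrite normrZ (ger0_norm sC0) ler_piMr//.
    exact: le_trans (T_le i x) x1.
  by rewrite lecE => /andP[].
have sTC i j x : sT i (sT j x) = sT j (sT i x).
  by rewrite /sT /= !linearZ/= TC.
have [_] := r_agler _ b_schur; rewrite dilate_multi_affine.
move=> /(_ _ (@multi_affine_taylor _ _ _) H sT sT_lt1 sTC).
set k := m.*2.+1; set f := fun_calc _ _ => f_le1.
have fE : f (v finset.set0) = (((r * s) ^+ k * #|B|%:R / M)%:C)%C *: g.
  rewrite /f fun_calc_multi_affine.
  transitivity (\sum_(A in B) (((r * s) ^+ k / M)%:C)%C *: g).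
    rewrite [RHS]big_mkcond/=; apply: eq_bigr => A _.
    rewrite (op_monomial_subset_index Tv) /b; case: ifP => AB; last by rewrite mul0r scale0r.
    rewrite vB// cardB// !scalerA; congr (_ *: _).
    rewrite -/k exprMn !rmorphM/= fmorphV/= !rmorphXn/=.
    rewrite [LHS](_ : _ = ((-1) ^+ eps A * (-1) ^+ eps A) *
      ((r%:C)%C ^+ k * (s%:C)%C ^+ k / (M%:C)%C)); last by ring.
    by rewrite -signr_addb addbb expr0 mul1r.
  rewrite sumr_const -scaler_nat scalerA; congr (_ *: _).
  rewrite -(rmorph_nat (real_complex R)) -rmorphM/=.
  by congr (_%:C)%C; rewrite mulrA [X in X / _]mulrC.
have rsk_ge0 : 0 <= (r * s) ^+ k * #|B|%:R / M.
  by rewrite divr_ge0 ?(ltW M0)// mulr_ge0// exprn_ge0// mulr_ge0 ?ltW.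
have : (complex.Re `|f (v finset.set0)|)%:E \in
   [set (complex.Re `|f x|)%:E | x in [set x : H | `|x| <= 1]].
  by rewrite inE; exists (v finset.set0) => //=; rewrite v0.
rewrite inE => /ereal_sup_ubound /le_trans /(_ f_le1).
rewrite lee_fin fE normrZ g1 mulr1 ger0_norm ?ler0c//=.
by rewrite ler_pdivrMr// mul1r.
Qed.
End Separation.

(** * Random signs *)

Section RandomSigns.
Variable R : realType.

(** The constant 2 in the exponent is not optimal; it allows a proof from
    1 + x <= exp x alone: for |x| < 1/2, exp x <= 1 / (1 - x), and for
    |x| >= 1/2 already |x| <= 2 x^2. *)
Lemma cosh_le_expR (x : R) : expR x + expR (- x) <= 2 * expR (2 * x ^+ 2).
Proof.
have [x_ge|x_lt] := lerP 2^-1 `|x|.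
  have exp_le y : `|y| = `|x| -> expR y <= expR (2 * x ^+ 2).
    move=> yx; rewrite ler_expR (le_trans (ler_norm _))// yx -real_normK ?num_real//.
    by have := normr_ge0 x; nra.
  by rewrite mulr_natl mulr2n lerD// exp_le ?normrN.
have [x_gt {}x_lt] : - 2^-1 < x /\ x < 2^-1.
  by move: x_lt; rewrite ltr_norml => /andP[].
have exp_le y : y < 1 -> expR y <= (1 - y)^-1.
  move=> y1; rewrite -[y in expR y]opprK expRN lef_pV2 ?posrE ?expR_gt0 ?subr_gt0//.
  by have := expR_ge1Dx (- y).
apply: (@le_trans _ _ ((1 - x)^-1 + (1 - - x)^-1)).
  by apply: lerD; apply: exp_le; lra.
have x2 : x ^+ 2 < 4^-1 by nra.
apply: (@le_trans _ _ (2 * (1 + 2 * x ^+ 2))); last first.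
  by rewrite ler_pM2l// expR_ge1Dx.
have -> : (1 - x)^-1 + (1 - - x)^-1 = 2 / (1 - x ^+ 2).
  by field; apply/and3P; split; lra.
by rewrite ler_pdivrMr; nra.
Qed.

(** Chernoff bound and union bound: if every choice of signs failed some test,
    the sum over all signs and tests of the exponentials of l times the signed
    sums would be both at least 2^|I| exp(l t) and at most
    |P| 2^|I| exp(2 l^2 N). *)
Lemma exists_signs (I P : finType) (v : P -> I -> R) (N t : R) :
  0 < N -> 0 < t -> (forall p, \sum_i v p i ^+ 2 <= N) ->
  #|P|%:R < expR (t ^+ 2 / (8 * N)) ->
  exists e : {ffun I -> bool}, forall p, \sum_i (-1) ^+ e i * v p i < t.
Proof.
move=> N0 t0 vN Pt; apply: contrapT => /forallNP no_signs.
(* This value maximizes l * t - 2 * l ^+ 2 * N. *)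
pose l := t / (4 * N).
have l0 : 0 < l by rewrite divr_gt0// mulr_gt0.
pose S (e : {ffun I -> bool}) p := \sum_i (-1) ^+ e i * v p i.
have low e : expR (l * t) <= \sum_p expR (l * S e p).
  have /existsNP[p /negP] := no_signs e; rewrite -leNgt => tS.
  rewrite (bigD1 p)//= ler_wpDr ?ler_expR ?ler_pM2l//.
  by apply: sumr_ge0 => *; exact: expR_ge0.
have upp p : \sum_e expR (l * S e p) <= 2 ^+ #|I| * expR (2 * l ^+ 2 * N).
  have -> : \sum_e expR (l * S e p) =
      \prod_i \sum_(b : bool) expR (l * ((-1) ^+ b * v p i)).
    rewrite bigA_distr_bigA/=; apply: eq_bigr => e _.
    by rewrite /S mulr_sumr expR_sum.
  apply: (@le_trans _ _ (\prod_i (2 * expR (2 * (l * v p i) ^+ 2)))).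
    apply: ler_prod => i _; rewrite big_bool/= expr1 expr0 mul1r mulN1r mulrN.
    rewrite addr_ge0 ?expR_ge0//= addrC; exact: cosh_le_expR.
  rewrite big_split/= prodr_const ler_pM2l ?exprn_gt0// -expR_sum ler_expR.
  under eq_bigr do rewrite exprMn mulrA.
  by rewrite -mulr_sumr ler_pM2l// mulr_gt0// exprn_gt0.
have : \sum_(e : {ffun I -> bool}) expR (l * t) <=
    \sum_(p : P) 2 ^+ #|I| * expR (2 * l ^+ 2 * N).
  apply: le_trans (ler_sum _ (fun p _ => upp p)); rewrite exchange_big/=.
  by apply: ler_sum => e _.
rewrite !sumr_const card_ffun card_bool -[leLHS]mulr_natl -[leRHS]mulr_natr natrX.
rewrite -mulrA ler_pM2l ?exprn_gt0// => tP.
have : expR (t ^+ 2 / (8 * N)) <= #|P|%:R.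
  rewrite -(ler_pM2l (expR_gt0 (2 * l ^+ 2 * N))); apply: le_trans tP.
  rewrite -expRD ler_expR le_eqVlt; apply/orP; left; apply/eqP.
  by rewrite /l; field; rewrite gt_eqF.
by rewrite leNgt Pt.
Qed.

End RandomSigns.

(** * Supremum of signed block polynomials on the polydisk *)

Section SupNorm.
Variable R : realType.
Local Notation C := R[i].

Definition corner (s : 'I_4) : C := 'i%C ^+ s.

(** Barycentric coordinates of z / 2 with respect to the fourth roots of
    unity; they are nonnegative as soon as |z| <= 1. *)
Definition corner_weight (z : C) (s : 'I_4) : R :=
  (1 + complex.Re ((- 'i%C) ^+ s * z)) / 4.

Lemma norm_corner s : `|corner s| = 1.
Proof. by rewrite normrX norm_im_unit expr1n. Qed.

Lemma Re_le_norm (z : C) (a : R) : `|z| <= (a%:C)%C -> `|complex.Re z| <= a.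
Proof. by move=> za; rewrite -lecR (le_trans (normc_ge_Re z)). Qed.

Lemma corner_weight_ge0 z s : `|z| <= 1 -> 0 <= corner_weight z s.
Proof.
move=> z1; have : `|complex.Re ((- 'i%C) ^+ s * z)| <= 1.
  by apply: Re_le_norm; rewrite normrM normrX normrN norm_im_unit expr1n mul1r.
by rewrite ler_norml /corner_weight => /andP[? _]; lra.
Qed.

Lemma sum_corner_weight z : \sum_s corner_weight z s = 1.
Proof.
case: z => x y; rewrite !big_ord_recr big_ord0 /corner_weight/=.
by field.
Qed.

Lemma corner_mean z : \sum_s (corner_weight z s)%:C%C * corner s = z / 2.
Proof.
have -> : z / 2 = ((2^-1)%:C)%C * z.
  by rewrite mulrC fmorphV/= rmorph_nat.
case: z => x y; rewrite !big_ord_recr big_ord0 /corner_weight/corner/=.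
by apply/eqP; rewrite eq_complex/=; apply/andP; split; apply/eqP; field.
Qed.

Variables (d k : nat) (B : {set {set 'I_d}}) (eps : {set 'I_d} -> bool).
Hypothesis cardB : forall c, c \in B -> #|c| = k.

Definition corner_point (f : {ffun 'I_d -> 'I_4}) : 'rV[C]_d :=
  \row_i corner (f i).

(** Each coordinate of z is twice a convex combination of fourth roots of
    unity, and every monomial has degree k and is affine in each variable. *)
Lemma signed_poly_corners (z : 'rV[C]_d) : signed_poly B eps z = 2 ^+ k *
  \sum_(f : {ffun 'I_d -> 'I_4}) (\prod_i corner_weight (z 0 i) (f i))%:C%C *
    signed_poly B eps (corner_point f).
Proof.
have prodE c : c \in B -> \prod_(i in c) z 0 i = 2 ^+ k *
    \sum_(f : {ffun 'I_d -> 'I_4}) (\prod_i corner_weight (z 0 i) (f i))%:C%C *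
      \prod_(i in c) corner_point f 0 i.
  move=> cB; transitivity (2 ^+ k * \prod_i \sum_s
      (corner_weight (z 0 i) s)%:C%C * if i \in c then corner s else 1).
    rewrite -(cardB cB) -prodr_const big_mkcond [X in X * _]big_mkcond -big_split/=.
    apply: eq_bigr => i _; case: ifP => _; first by rewrite corner_mean mulrC divfK.
    under eq_bigr do rewrite mulr1.
    by rewrite -rmorph_sum/= sum_corner_weight mulr1.
  rewrite bigA_distr_bigA/=; congr (_ * _); apply: eq_bigr => f _.
  rewrite rmorph_prod [X in _ = _ * X]big_mkcond -big_split/=.
  by apply: eq_bigr => i _; rewrite mxE.
rewrite /signed_poly (eq_bigr _ (fun c cB => congr1 _ (prodE c cB))).
under eq_bigr do rewrite mulrCA mulr_sumr.
rewrite -mulr_sumr exchange_big/=; congr (_ * _); apply: eq_bigr => f _.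
by rewrite mulr_sumr; apply: eq_bigr => c _; rewrite mulrCA.
Qed.

Lemma signed_poly_le (a : R) :
  (forall f, `|signed_poly B eps (corner_point f)| <= (a%:C)%C) ->
  forall z, polydisk z -> `|signed_poly B eps z| <= ((2 ^+ k * a)%:C)%C.
Proof.
move=> corner_le z zD; rewrite signed_poly_corners normrM normrX normr_nat.
rewrite rmorphM/= rmorphXn/= rmorph_nat ler_wpM2l ?exprn_ge0//.
apply: le_trans (ler_norm_sum _ _ _) _.
have w_ge0 (f : {ffun 'I_d -> 'I_4}) : 0 <= \prod_i corner_weight (z 0 i) (f i).
  by apply: prodr_ge0 => i _; apply: corner_weight_ge0; exact/ltW/zD.
apply: (@le_trans _ _ (\sum_(f : {ffun 'I_d -> 'I_4})
    (\prod_i corner_weight (z 0 i) (f i))%:C%C * (a%:C)%C)).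
  apply: ler_sum => f _; rewrite normrM ger0_norm ?ler0c// ler_wpM2l ?ler0c//.
rewrite -mulr_suml -rmorph_sum/= -(bigA_distr_bigA (fun i s => corner_weight (z 0 i) s)).
by rewrite big1 ?mul1r// => i _; exact: sum_corner_weight.
Qed.

Lemma norm_le_corners (z : C) (a : R) :
  (forall s, complex.Re (corner s * z) <= a) -> `|z| <= ((2 * a)%:C)%C.
Proof.
move=> za; rewrite [z in `|z|]complexE (le_trans (ler_normD _ _))//.
rewrite normrM norm_im_unit mul1r.
rewrite !norm_real_complex -rmorphD lecR mulr_natl mulr2n.
have := (za 0, za 1, za 2%:R, za 3%:R).
case: z za => x y _ /=; rewrite /corner/= => -[[[h0 h1] h2] h3].
by rewrite lerD// ler_norml; apply/andP; split; lra.
Qed.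

End SupNorm.

(** The tests are the real parts of p multiplied by each fourth root of unity,
    at each of the 4^d corner points. *)
Lemma exists_small_signed_poly (R : realType) (d k : nat) (B : {set {set 'I_d}}) :
  (1 < d)%N -> (0 < #|B|)%N -> (forall c, c \in B -> #|c| = k) ->
  exists eps : {set 'I_d} -> bool, forall z : 'rV[R[i]]_d, polydisk z ->
   `|signed_poly B eps z| <=
     ((2 ^+ k.+1 * Num.sqrt (32 * #|B|%:R * d%:R) : R)%:C)%C.
Proof.
move=> d1 B0 cardB; set t := Num.sqrt _.
have B0' : 0 < #|B|%:R :> R by rewrite ltr0n.
have d0 : 0 < d%:R :> R by rewrite ltr0n ltnW.
have t0 : 0 < t by rewrite sqrtr_gt0 !mulr_gt0.
pose P : finType := ({ffun 'I_d -> 'I_4} * 'I_4)%type.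
pose v (p : P) (c : {set 'I_d}) : R := if c \in B then
  complex.Re (corner R p.2 * \prod_(i in c) corner_point R p.1 0 i) else 0.
have [||eps epsP] := @exists_signs R _ P v #|B|%:R t B0' t0.
- move=> p; rewrite -sum1_card natr_sum big_mkcond [leRHS]big_mkcond.
  apply: ler_sum => c _; rewrite /v; case: ifP => cB; last by rewrite expr0n.
  rewrite -real_normK ?num_real// expr_le1// Re_le_norm//.
  rewrite normrM norm_corner mul1r normr_prod big1// => i _.
  by rewrite mxE norm_corner.
- have -> : t ^+ 2 / (8 * #|B|%:R) = (4 * d)%:R.
    rewrite sqr_sqrtr ?natrM; last by rewrite !mulr_ge0.
    by field; rewrite gt_eqF.
  rewrite card_prod card_ffun !card_ord -expnSr.
  apply: (@lt_le_trans _ _ ((2 ^ (4 * d))%:R)).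
    have -> : (4 ^ d.+1 = 2 ^ (2 * d.+1))%N by rewrite expnM.
    by rewrite ltr_nat ltn_exp2l//; lia.
  rewrite natrX -[X in expR X]mulr1 expRM_natl.
  apply: lerXn2r; rewrite ?nnegrE ?expR_ge0//; exact: expR_ge1Dx.
exists eps => z zD; rewrite exprSr -mulrA; apply: signed_poly_le => // f.
apply: norm_le_corners => s; apply: le_trans (ltW (epsP (f, s))).
rewrite /signed_poly mulr_sumr raddf_sum/= big_mkcond.
apply: ler_sum => c _; rewrite /v; case: ifP => cB; last by rewrite mulr0.
by rewrite mulrCA; case: (eps c); rewrite ?expr1 ?expr0 ?mulN1r ?mul1r ?raddfN.
Qed.

(** * Packings of blocks *)

Section Packing.
Local Open Scope nat_scope.

Lemma mul_bin_trinomial d k j : j <= k -> k <= d ->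
  'C(d, k) * 'C(k, j) = 'C(d, j) * 'C(d - j, k - j).
Proof.
move=> jk kd; apply/eqP.
have f0 : 0 < j`! * (k - j)`! * (d - k)`! by rewrite !muln_gt0 !fact_gt0.
rewrite -(eqn_pmul2r f0); apply/eqP.
transitivity d`!.
  by rewrite -(bin_fact kd) -(bin_fact jk); ring.
have kjd : k - j <= d - j by rewrite leq_sub2r.
rewrite -(bin_fact (leq_trans jk kd)) -(bin_fact kjd).
have -> : d - j - (k - j) = d - k by lia.
by ring.
Qed.

Variable T : finType.

Lemma card_supersets (A : {set T}) k : #|A| <= k ->
  #|[set S : {set T} | (A \subset S) && (#|S| == k)]%SET| <= 'C(#|T| - #|A|, k - #|A|).
Proof.
move=> Ak; have <- : #|~: A| = #|T| - #|A| by rewrite -(cardsC A) addKn.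
rewrite -cards_draws.
rewrite -(@card_in_imset _ _ (fun S => S :\: A)
  (mem [set S : {set T} | (A \subset S) && (#|S| == k)]%SET)).
  apply: subset_leq_card; apply/fintype.subsetP => S0 /finset.imsetP[S].
  rewrite !inE => /andP[AS /eqP Sk] ->; rewrite cardsDS// Sk eqxx andbT.
  by rewrite finset.setDE finset.subsetIr.
move=> S S'; rewrite !inE => /andP[AS _] /andP[AS' _] SS'.
apply/setP => x; have /setP/(_ x) := SS'; rewrite !inE.
by case: (boolP (x \in A)) => //= xA; rewrite !(fintype.subsetP _ _ xA).
Qed.

(** In a maximal packing every set of size 2m + 1 meets some block in more than
    m points, hence contains one of the subsets of size m + 1 of the blocks.
    Counting the supersets of these small sets gives the bound. *)
Lemma exists_packing m : m.*2.+1 <= #|T| ->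
  exists B : {set {set T}},
  [/\ forall c, c \in B -> #|c| = m.*2.+1,
      forall c c', c \in B -> c' \in B -> c != c' -> #|c :&: c'| <= m
    & 'C(#|T|, m.+1) <= #|B| * 'C(m.*2.+1, m.+1) ^ 2].
Proof.
move=> mT; set k := m.*2.+1; set j := m.+1.
have jk : j <= k by rewrite /j /k ltnS -addnn leq_addr.
pose packing (B : {set {set T}}) := [forall c in B, #|c| == k] &&
  [forall c in B, forall c' in B, (c != c') ==> (#|c :&: c'| <= m)].
have [B /maxsetP[/andP[/forall_inP cardB /forall_inP interB] maxB]] :
    {B | maxset packing B}.
  apply: ex_maxset; exists finset.set0; apply/andP.
  by split; apply/forall_inP => c; rewrite inE.
have meetB (S : {set T}) : #|S| = k -> exists2 c, c \in B & m < #|S :&: c|.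
  move=> Sk; apply: contrapT => S_far.
  have {}S_far c : c \in B -> #|S :&: c| <= m.
    by move=> cB; rewrite leqNgt; apply/negP => Sc; apply: S_far; exists c.
  have SB : S |: B = B.
    apply: maxB; last exact: finset.subsetUr.
    apply/andP; split; apply/forall_inP => c; rewrite !inE.
      by move=> /orP[/eqP ->|/cardB//]; rewrite Sk.
    move=> cSB; apply/forall_inP => c'; rewrite !inE => c'SB; apply/implyP => cc'.
    move: cSB c'SB cc' => /orP[/eqP ->|cB] /orP[/eqP ->|c'B]; rewrite ?eqxx//.
    - by rewrite S_far.
    - by rewrite finset.setIC S_far.
    - by move=> cc'; have /forall_inP/(_ _ c'B)/implyP/(_ cc') := interB _ cB.
  have : S \in B by rewrite -SB setU11.
  by move=> /S_far; rewrite finset.setIid Sk leqNgt jk.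
exists B; split=> [c /cardB/eqP//|c c' cB c'B cc'|].
  by have /forall_inP/(_ _ c'B)/implyP/(_ cc') := interB _ cB.
have count : 'C(#|T|, k) <= #|B| * ('C(k, j) * 'C(#|T| - j, k - j)).
  rewrite -card_draws -sum1_card.
  apply: (@leq_trans (\sum_(S : {set T} | #|S| == k) \sum_(c in B)
      \sum_(A : {set T} | (A \subset c) && (#|A| == j)) (A \subset S))).
    rewrite big_mkcond [leqRHS]big_mkcond; apply: leq_sum => S _; rewrite inE.
    case: eqP => // /meetB[c cB Sc]; rewrite (bigD1 c)//=.
    apply: leq_trans (leq_addr _ _).
    have [A AS Aj] : exists2 A : {set T}, A \subset S :&: c & #|A| == j.
      have : 0 < 'C(#|S :&: c|, j) by rewrite bin_gt0.
      rewrite -cards_draws.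
      by move=> /card_gt0P[A]; rewrite inE => /andP[]; exists A.
    move: AS; rewrite finset.subsetI => /andP[AS Ac].
    by rewrite (bigD1 A) ?Ac//= AS.
  rewrite exchange_big/= -sum_nat_const; apply: leq_sum => c cB.
  rewrite exchange_big/=.
  have <- : \sum_(A : {set T} | (A \subset c) && (#|A| == j)) 1 = 'C(k, j).
    rewrite -(eqP (cardB _ cB)) -cards_draws -sum1_card.
    by apply: eq_bigl => A; rewrite finset.in_set.
  rewrite big_distrl/=.
  apply: leq_sum => A /andP[_ /eqP Aj].
  rewrite mul1n -Aj; apply: leq_trans (card_supersets _); last by rewrite Aj.
  rewrite -[leqRHS]sum1_card big_mkcond [leqRHS]big_mkcond.
  apply: leq_sum => S _; rewrite finset.in_set andbC.
  by case: (#|S| == k); case: (A \subset S).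
have C0 : 0 < 'C(#|T| - j, k - j) by rewrite bin_gt0 leq_sub2r.
rewrite -(leq_pmul2r C0) -mul_bin_trinomial//.
rewrite -mulnA [_ ^ 2 * _]mulnC expnS expn1 [X in _ <= X]mulnA [X in _ <= X]mulnA.
by rewrite leq_mul2r -mulnA [X in _ * X]mulnC count orbT.
Qed.

End Packing.

(** * The radius *)

Lemma expn_le_bin d n : (n <= d)%N -> (d ^ n <= 'C(d, n) * n ^ n)%N.
Proof.
elim: n d => [|n IHn] [|d]// nd.
have -> : ('C(d.+1, n.+1) * n.+1 ^ n.+1 = d.+1 * ('C(d, n) * n.+1 ^ n))%N.
  by rewrite expnS [LHS]mulnA [X in (X * _)%N]mulnC -mul_bin_diag mulnA.
rewrite expnS leq_pmul2l//; case: n nd IHn => [|n] nd IHn; first by rewrite bin0.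
have nn0 : (0 < n.+1 ^ n.+1)%N by rewrite expn_gt0.
rewrite -(leq_pmul2r nn0) -expnMn.
apply: (@leq_trans ((d * n.+2) ^ n.+1)); first by rewrite leq_exp2r//; lia.
by rewrite expnMn mulnAC leq_mul2r IHn ?orbT.
Qed.

Lemma bin_le_expn k n : ('C(k, n) <= 2 ^ k)%N.
Proof.
rewrite -[k in (2 ^ k)%N]card_ord -cardsT -card_powerset -[k in 'C(k, _)]card_ord -card_draws.
by apply: subset_leq_card; apply/fintype.subsetP => A _; rewrite powersetT inE.
Qed.

Lemma expn256 m : (256 ^ m.+1 = 4 ^ m.*2.+2 * 4 ^ m.*2.+1 * 4)%N.
Proof.
rewrite -expnD -expnSr (_ : (m.*2.+2 + m.*2.+1).+1 = 4 * m.+1)%N; last by lia.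
by rewrite expnM; congr (_ ^ _)%N.
Qed.

Section Numerics.
Variable R : realType.

Lemma ln2_ge : 2^-1 <= ln 2 :> R.
Proof.
rewrite -[leLHS]expRK ler_ln ?posrE ?expR_gt0//.
have : 1 - 2^-1 <= expR (- 2^-1) :> R by have := expR_ge1Dx (- 2^-1 : R).
rewrite expRN => h.
have e0 := expR_gt0 (2^-1 : R).
have : (1 - 2^-1) * expR 2^-1 <= 1 :> R.
  by rewrite -[leRHS](mulVf (lt0r_neq0 e0)) ler_pM2r.
lra.
Qed.

(** The exponent n of order log d for which the loss 8 d of the union bound
    is absorbed by 2^n. *)
Lemma degree_choice d : (2 <= d)%N ->
  exists n, [/\ (0 < n)%N, (8 * d <= 2 ^ n)%N & n%:R <= 10 * ln d%:R :> R].
Proof.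
move=> d2; exists (up_log 2 d + 3)%N; split; first by rewrite addn3.
  by rewrite expnD mulnC leq_mul2r/= up_logP.
have d0 : 0 < d%:R :> R by rewrite ltr0n ltnW.
have lnd : ln 2 <= ln d%:R :> R by rewrite ler_ln ?posrE// ler_nat.
have ln2 := ln2_ge.
have : (up_log 2 d).-1%:R * ln 2 <= ln d%:R :> R.
  have p0 : 0 < 2 ^+ (up_log 2 d).-1 :> R by rewrite exprn_gt0.
  rewrite mulr_natl -lnXn// ler_ln ?posrE// -natrX ler_nat ltnW//.
  by have /andP[] := up_log_bounds (isT : 1 < 2)%N d2.
have : (0 < up_log 2 d)%N by rewrite up_log_gt0.
case: (up_log 2 d) => // u _ /=; rewrite -natr1 natrD.
set L := ln d%:R in lnd *; set l := ln 2 in lnd ln2 *; have := ler0n R u; nra.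
Qed.

(** Squaring the inequality of [agler_bound] and inserting the size of the
    packing gives (r s)^(2k) d^n <= 128 d 16^k n^n with k = 2n - 1; when k > d
    there is no block, but then d < 2n and the bound is trivial. *)
Lemma radius_bound d n (r s : R) : (2 <= d)%N -> (0 < n)%N -> (8 * d <= 2 ^ n)%N ->
  0 < r < 1 -> (forall f : 'rV[R[i]]_d -> R[i], schur f -> agler (dilate r f)) ->
  0 < s < 1 -> (r * s) ^+ 4 * d%:R <= 512 * n%:R.
Proof.
move=> d2 n0 dn /andP[r0 r1] r_agler /andP[s0 s1].
case: n n0 dn => // m _; set n := m.+1 => dn; set k := m.*2.+1.
have kn : (k * 2 <= 4 * n)%N by rewrite /k /n; clear; lia.
have rs0 : 0 < r * s by rewrite mulr_gt0.
have rs1 : r * s <= 1 by rewrite mulr_ile1// ltW.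
have d0 : 0 < d%:R :> R by rewrite ltr0n ltnW.
have [kd|dk] := leqP k d; last first.
  apply: (@le_trans _ _ (1 * d%:R)); first by rewrite ler_pM2r// exprn_ile1// ltW.
  by rewrite mul1r -natrM ler_nat /n; lia.
have kT : (k <= #|'I_d|)%N by rewrite card_ord.
have [B [cardB interB]] := exists_packing kT; rewrite card_ord -/k -/n => CB.
have nd : (n <= d)%N by apply: leq_trans kd; rewrite /n /k ltnS -addnn leq_addr.
have B0 : (0 < #|B|)%N.
  have := leq_trans _ CB; rewrite -/n => /(_ 1%N); rewrite bin_gt0 nd => /(_ isT).
  by rewrite muln_gt0 => /andP[].
have [eps p_le] := @exists_small_signed_poly R d k B d2 B0 cardB.
set t := Num.sqrt _ in p_le.
have N0 : 0 < #|B|%:R :> R by rewrite ltr0n.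
have t0 : 0 < t by rewrite sqrtr_gt0 !mulr_gt0.
have M0 : 0 < 2 ^+ k.+1 * t by rewrite mulr_gt0// exprn_gt0.
have := agler_bound cardB interB M0 p_le r0 r_agler (introT andP (conj s0 s1)).
rewrite -/k; set x := r * s in rs0 rs1 *.
move=> xNM.
have xk0 : 0 <= x ^+ k by rewrite exprn_ge0 ?ltW.
have step1 : (x ^+ k) ^+ 2 * #|B|%:R <= 4 ^+ k.+1 * (32 * d%:R).
  rewrite -(ler_pM2r N0).
  have -> : 4 ^+ k.+1 * (32 * d%:R) * #|B|%:R = (2 ^+ k.+1 * t) ^+ 2.
    rewrite exprMn sqr_sqrtr ?mulr_ge0 ?ltW// -exprM mulnC exprM.
    by rewrite (_ : 2 ^+ 2 = 4 :> R); [ring|rewrite -natrX].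
  have -> : (x ^+ k) ^+ 2 * #|B|%:R * #|B|%:R = (x ^+ k * #|B|%:R) ^+ 2 by ring.
  by rewrite ler_sqr ?nnegrE ?(ltW M0) ?(mulr_ge0 xk0 (ltW N0)).
have step2 : d%:R ^+ n <= #|B|%:R * 4 ^+ k * n%:R ^+ n :> R.
  rewrite -!natrX -!natrM ler_nat.
  apply: leq_trans (expn_le_bin nd) _; rewrite leq_mul2r; apply/orP; right.
  apply: leq_trans CB _; rewrite leq_mul2l; apply/orP; right.
  rewrite (_ : 4 ^ k = (2 ^ k) ^ 2)%N ?leq_exp2r ?bin_le_expn//.
  by rewrite -expnM mulnC expnM.
have step3 : (x ^+ 4 * d%:R) ^+ n <= (512 * n%:R) ^+ n.
  apply: (@le_trans _ _ ((x ^+ k) ^+ 2 * d%:R ^+ n)).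
    rewrite exprMn ler_pM2r ?exprn_gt0// -!exprM.
    exact: (ler_wiXn2l (ltW rs0) rs1 kn).
  apply: (@le_trans _ _ (4 ^+ k.+1 * (32 * d%:R) * (4 ^+ k * n%:R ^+ n))).
    apply: (@le_trans _ _ ((x ^+ k) ^+ 2 * (#|B|%:R * 4 ^+ k * n%:R ^+ n))).
      by rewrite ler_wpM2l// exprn_ge0.
    rewrite -[#|B|%:R * _ * _]mulrA mulrA ler_wpM2r// mulr_ge0 ?exprn_ge0//.
  rewrite -!natrX -!natrM -natrX ler_nat.
  have -> : (4 ^ k.+1 * (32 * d) * (4 ^ k * n ^ n) = 256 ^ n * (8 * d) * n ^ n)%N.
    by rewrite expn256 -/k -/n; move: (4 ^ k)%N (4 ^ k.+1)%N => u v; ring.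
  rewrite !expnMn leq_mul2r; apply/orP; right.
  by rewrite (_ : 512 = 256 * 2)%N// expnMn leq_mul2l dn orbT.
have x4d0 : 0 <= x ^+ 4 * d%:R by rewrite mulr_ge0 ?exprn_ge0 ?(ltW rs0).
have n512 : 0 <= 512 * n%:R :> R by rewrite mulr_ge0 ?ler0n.
by rewrite -(ler_pXn2r (isT : (0 < n)%N) x4d0 n512).
Qed.

End Numerics.

Theorem theorem1p5 (R : realType) :
  exists c : R, 0 < c /\
    forall d : nat, (2 <= d)%N ->
      schur_agler_radius R d <= c * (ln (d%:R : R) / d%:R) `^ 4^-1.
Proof.
exists 9; split=> // d d2.
have [n [n0 dn n_le]] := degree_choice R d2.
have d0 : 0 < d%:R :> R by rewrite ltr0n ltnW.
have lnd0 : 0 <= ln d%:R :> R by rewrite ln_ge0// ler1n ltnW.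
set q := ln d%:R / d%:R; set K := 9 * q `^ 4^-1.
have q0 : 0 <= q by exact: divr_ge0 lnd0 (ltW d0).
have K0 : 0 <= K by rewrite mulr_ge0// powR_ge0.
have K4 : K ^+ 4 = 6561 * q.
  rewrite exprMn -[(q `^ _) ^+ 4]powR_mulrn ?powR_ge0// -powRrM mulVf// powRr1//.
  by congr (_ * _); rewrite -natrX.
have [S0|/set0P S0] := eqVneq [set r : R | 0 < r < 1 /\
    forall f : 'rV[R[i]]_d -> R[i], schur f -> agler (dilate r f)] set0.
  by rewrite /schur_agler_radius S0 sup0.
apply: ge_sup => // r /= [r01 r_agler]; rewrite leNgt; apply/negP => Kr.
have /andP[r0 r1] := r01.
have rs_le s : 0 < s < 1 -> r * s <= K.
  move=> s01; have /andP[s_gt0 _] := s01.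
  rewrite -(ler_pXn2r (isT : (0 < 4)%N)) ?nnegrE ?(mulr_ge0 (ltW r0) (ltW s_gt0))// K4.
  have := radius_bound d2 n0 dn r01 r_agler s01.
  rewrite -ler_pdivlMr// => /le_trans; apply.
  rewrite /q mulrA ler_pM2r ?invr_gt0//.
  by move: n_le lnd0; move: n%:R (ln d%:R) => u v; lra.
(* The scale that brings r to the midpoint of K and r. *)
have /rs_le : 0 < (K + r) / (2 * r) < 1.
  by rewrite divr_gt0 ?ltr_pdivrMr ?mulr_gt0//; lra.
have -> : r * ((K + r) / (2 * r)) = (K + r) / 2 by field; rewrite gt_eqF.
by lra.
Qed.
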